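(* Let $\mathcal{G}=(\mathcal{V},\mathcal{E},\mathcal{P})$ be an uncertain graph, $e_{uv}\in\mathcal{E}$ an edge, and $G_i\sqsubseteq\mathcal{G}$ a possible world at the $i$-th iteration, with edge set $E_i$. Then the edge influence set of $e_{uv}$ in $G_i$, denoted $S_i(e_{uv})$, is given by $$S_i(e_{uv})=\{e_{uw} : e_{vw}\in E_i,\ w\in C_{\mathcal{G}}(u,v)\}.$$
   Context: An uncertain graph $\mathcal{G}=(\mathcal{V},\mathcal{E},\mathcal{P})$ consists of a node set $\mathcal{V}$, a set $\mathcal{E}$ of undirected edges ($e_{uv}$ denotes the edge between nodes $u$ and $v$), and a function $\mathcal{P}:\mathcal{E}\to(0,1]$ assigning to each edge $e$ an existence probability $p(e)$. A possible world of $\mathcal{G}$, written $G\sqsubseteq\mathcal{G}$, is a deterministic graph $G=(V,E)$ with $V=\mathcal{V}$ and $E\subseteq\mathcal{E}$. $C_G(u,v)=N_G(u)\cap N_G(v)$ is the set of common neighbors of $u$ and $v$ in $G$, where $N_G(u)$ is the set of neighbors of $u$ in $G$; $C_{\mathcal{G}}(u,v)$ is the set of common neighbors of $u$ and $v$ in the topological structure $(\mathcal{V},\mathcal{E})$ of $\mathcal{G}$, ignoring edge probabilities. The expected number of common neighbors is $\overline{C}_{\mathcal{G}}(u,v)=\sum_{w\in C_{\mathcal{G}}(u,v)}p(e_{uw})\,p(e_{vw})$. For $e_{xy}\in\mathcal{E}$, the edge discrepancy in $G$ is $dis_G(e_{xy})=|C_G(x,y)|-\overline{C}_{\mathcal{G}}(x,y)$.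 An iterative refinement produces possible worlds $G_0,G_1,\dots$; at the $i$-th iteration an edge $e_{uv}\in\mathcal{E}$ is selected and one considers changing its existence state in the current possible world $G_i$, i.e. removing $e_{uv}$ from $E_i$ if $e_{uv}\in E_i$ and adding it to $E_i$ if $e_{uv}\notin E_i$, which yields $G_{i+1}$. The edge influence set $S_i(e_{uv})$ of $e_{uv}$ in $G_i$ is the set identifying the edges whose edge discrepancies are affected by this state change of $e_{uv}$.
   Formalization: With u, v fixed the printed formula is false (triangle a,b,c, E_i={e_ac}, u=a, v=b: it gives the empty set, but e_bc is affected); the formal statement takes the union of the formula for (u,v) and for (v,u). *)

(* Defs.v *)
(* World: MathComp. *)
From HB Require Import structures.
From mathcomp Require Import all_boot all_order all_algebra.

Set Implicit Arguments.
Unset Strict Implicit.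
Unset Printing Implicit Defensive.

Import Order.TTheory GRing.Theory Num.Theory.
Local Open Scope ring_scope.

Section EdgeSets.
Variable V : finType.

(* Undirected: [edge u v = edge v u] holds as an equality of sets. *)
Definition edge (u v : V) : {set V} := [set u; v].

(* A graph on the fixed node set V is given by its edge set E; edge sets that
   matter below contain only two-element sets, so there are no loops. *)
Definition nbr (E : {set {set V}}) (u : V) : {set V} :=
  [set w | edge u w \in E].

Definition common_nbr (E : {set {set V}}) (u v : V) : {set V} :=
  nbr E u :&: nbr E v.

Definition flip (E : {set {set V}}) (e : {set V}) : {set {set V}} :=
  if e \in E then E :\ e else e |: E.

End EdgeSets.

(* [prob] is total for convenience; only its values on [edges] are constrained,
   and only those are ever used. *)
Record uncertain_graph (R : realFieldType) (V : finType) := UncertainGraph {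
  edges : {set {set V}};
  edges_card2 : forall e, e \in edges -> #|e| = 2%N;
  prob : {set V} -> R;
  prob_range : forall e, e \in edges -> 0 < prob e <= 1
}.

Section Discrepancy.
Variables (R : realFieldType) (V : finType) (UG : uncertain_graph R V).

(* A possible world keeps all the nodes, so it is a subset of the edges. *)
Definition possible_world (E : {set {set V}}) : bool := E \subset edges UG.

Definition expected_common_nbr (u v : V) : R :=
  \sum_(w in common_nbr (edges UG) u v)
    prob UG (edge u w) * prob UG (edge v w).

Definition discrepancy (E : {set {set V}}) (x y : V) : R :=
  #|common_nbr E x y|%:R - expected_common_nbr x y.

(* The edges of the uncertain graph, present in the world E or not, whose
   discrepancy takes another value once the state of e is changed in E. *)
Definition influence_set (E : {set {set V}}) (e : {set V}) : {set {set V}} :=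
  [set edge x y | x in V, y in V &
     (edge x y \in edges UG) &&
     (discrepancy (flip E e) x y != discrepancy E x y)].

End Discrepancy.

(* Main.v *)
Require Import Defs.
From mathcomp Require Import all_boot all_order all_algebra.

(* Toggling [edge u v] can only change the common neighbors of x and y by the
   membership of an endpoint of [edge u v].  If [edge x y] has both or none of
   its ends in [edge u v], nothing changes, because there are no loops.  If x is u
   and y is not v, only the membership of v is affected, and it is toggled exactly
   when [edge v y] is in the current world; the number of common neighbors then
   changes by one. *)

Set Implicit Arguments.
Unset Strict Implicit.
Unset Printing Implicit Defensive.

Import Order.TTheory GRing.Theory Num.Theory.
Local Open Scope ring_scope.

Section EdgeSetFlip.
Variable V : finType.
Implicit Types (E : {set {set V}}) (e f : {set V}) (u v w x y : V).

Lemma edgeC u v : edge u v = edge v u.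
Proof. exact: setUC. Qed.

Lemma common_nbrC E u v : common_nbr E u v = common_nbr E v u.
Proof. exact: setIC. Qed.

Lemma card_edge u v : (#|edge u v| == 2%N) = (u != v).
Proof. by rewrite cards2; case: (u != v). Qed.

Lemma edge_inj x v w : (edge x v == edge x w) = (v == w).
Proof.
apply/eqP/eqP => [eqE|-> //].
have : v \in edge x w by rewrite -eqE set22.
rewrite !inE => /orP[/eqP vx|/eqP //].
have : w \in edge x v by rewrite eqE set22.
by rewrite vx !inE orbb => /eqP.
Qed.

Lemma in_flip E e f : (f \in flip E e) = (f \in E) (+) (f == e).
Proof.
by rewrite /flip; case: ifP => eE; rewrite !inE; case: eqP => [->|_];
  rewrite ?eE ?addbF.
Qed.

Lemma common_nbr_flip_balanced E e x y :
  {in E, forall f, #|f| = 2%N} -> #|e| = 2%N -> x != y ->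
  (x \in e) = (y \in e) -> common_nbr (flip E e) x y = common_nbr E x y.
Proof.
move=> E2 e2 neq_xy xye.
have loop z : edge z z \notin E.
  by apply/negP => /E2/eqP; rewrite card_edge eqxx.
have loop_e z : edge z z != e.
  by apply/eqP => ez; move/eqP: e2; rewrite -ez card_edge eqxx.
apply/setP => w; rewrite !inE !in_flip.
have [xe|xNe] := boolP (x \in e); last first.
  have neq_e z : z \notin e -> (edge z w == e) = false.
    by apply: contraNF => /eqP <-; rewrite set21.
  by rewrite !neq_e -?xye // !addbF.
have -> : e = edge x y.
  apply/esym/eqP; rewrite eqEcard subUset !sub1set -xye xe e2.
  by rewrite cards2 neq_xy.
rewrite edge_inj [edge x y]edgeC edge_inj.
have [->|_] := eqVneq w y.
  by rewrite (negPf (loop y)) [y == x]eq_sym (negPf neq_xy) !andbF.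
by have [->|_] := eqVneq w x; rewrite ?(negPf (loop x)) ?addbF.
Qed.

Lemma in_common_nbr_flip E u v y w : y != u -> y != v ->
  (w \in common_nbr (flip E (edge u v)) u y) =
    (w \in common_nbr E u y) (+) ((w == v) && (edge v y \in E)).
Proof.
move=> yu yv; rewrite !inE !in_flip edge_inj.
have /negPf-> : edge y w != edge u v.
  apply/eqP => /setP/(_ y).
  by rewrite !inE eqxx (negPf yu) (negPf yv).
by rewrite addbF andb_addl; case: eqP => //= ->; rewrite [edge y v]edgeC.
Qed.

Lemma card_common_nbr_flip E u v y : y != u -> y != v ->
  (#|common_nbr (flip E (edge u v)) u y| != #|common_nbr E u y|) =
    (edge v y \in E).
Proof.
move=> yu yv; rewrite (cardsD1 v) (cardsD1 v (common_nbr E u y)).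
have -> : common_nbr (flip E (edge u v)) u y :\ v = common_nbr E u y :\ v.
  apply/setP => w; rewrite !in_setD1 in_common_nbr_flip //.
  by case: (w == v); rewrite /= ?addbF.
rewrite eqn_add2r in_common_nbr_flip // eqxx /=.
by case: (v \in _); case: (edge v y \in E).
Qed.

End EdgeSetFlip.

Section Influence.
Variables (R : realFieldType) (V : finType) (UG : uncertain_graph R V).
Implicit Types (E : {set {set V}}) (e : {set V}) (u v x y : V).

Lemma edges_neq x y : edge x y \in edges UG -> x != y.
Proof. by move=> /edges_card2/eqP; rewrite card_edge. Qed.

Lemma eq_discrepancy E E' x y :
  (discrepancy UG E x y == discrepancy UG E' x y) =
    (#|common_nbr E x y| == #|common_nbr E' x y|).
Proof. by rewrite (inj_eq (addIr _)) eqr_nat. Qed.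

Lemma influence_setP E e f :
  reflect (exists x y, [/\ f = edge x y, edge x y \in edges UG &
             #|common_nbr (flip E e) x y| != #|common_nbr E x y|])
          (f \in influence_set UG E e).
Proof.
apply: (iffP imset2P) => [[x y _]|[x [y [-> xyG neq]]]].
  by rewrite !inE /= eq_discrepancy => /andP[xyG neq] ->; exists x, y.
by exists x y; rewrite // !inE /= eq_discrepancy xyG.
Qed.

Lemma sub_influence_set E u v : possible_world UG E ->
  [set edge u w | w in common_nbr (edges UG) u v & edge v w \in E]
    \subset influence_set UG E (edge u v).
Proof.
move=> EG; apply/subsetP => _ /imsetP[w + ->].
rewrite !inE => /andP[/andP[uwG vwG] vwE].
apply/influence_setP; exists u, w; split=> //.
by rewrite card_common_nbr_flip // eq_sym edges_neq.
Qed.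

Lemma influence_set_mem E u v y : possible_world UG E ->
  edge u y \in edges UG -> y != v ->
  #|common_nbr (flip E (edge u v)) u y| != #|common_nbr E u y| ->
  edge u y \in
    [set edge u w | w in common_nbr (edges UG) u v & edge v w \in E].
Proof.
move=> EG uyG yv; have yu : y != u by rewrite eq_sym edges_neq.
rewrite card_common_nbr_flip // => vyE; apply/imsetP; exists y => //.
by rewrite !inE uyG vyE (subsetP EG).
Qed.

End Influence.

Theorem theorem3 (R : realFieldType) (V : finType) (UG : uncertain_graph R V)
    (Ei : {set {set V}}) (u v : V) :
  possible_world UG Ei ->
  edge u v \in edges UG ->
  influence_set UG Ei (edge u v) =
    [set edge u w | w in common_nbr (edges UG) u v & edge v w \in Ei] :|:
    [set edge v w | w in common_nbr (edges UG) v u & edge u w \in Ei].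
Proof.
move=> EG uvG; apply/eqP; rewrite eqEsubset subUset sub_influence_set //=.
rewrite [in X in _ && X]edgeC sub_influence_set // andbT.
apply/subsetP => _ /influence_setP[x [y [-> xyG neq]]].
have unbalanced : (x \in edge u v) != (y \in edge u v).
  apply: contraNneq neq => xye.
  rewrite common_nbr_flip_balanced ?(edges_neq xyG) ?(edges_card2 uvG) //.
  by move=> f /(subsetP EG)/edges_card2.
wlog xe : x y xyG neq unbalanced / x \in edge u v => [wlog_xe|].
  have [/wlog_xe|xNe] := boolP (x \in edge u v); first exact.
  rewrite edgeC; apply: wlog_xe.
  - by rewrite edgeC.
  - by rewrite ![common_nbr _ y x]common_nbrC.
  - by rewrite eq_sym.
  - by move: unbalanced; rewrite (negPf xNe); case: (y \in _).
move: unbalanced; rewrite xe eq_sym eqb_id !inE negb_or => /andP[yu yv].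
move: xe neq xyG; rewrite !inE => /orP[]/eqP-> neq xyG.
  by rewrite influence_set_mem.
by rewrite [X in _ || X]influence_set_mem ?orbT // [edge v u]edgeC.
Qed.
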